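(* Let $n\ge1$ and let $(c_P),(d_P)\in X_{1,n}$. Suppose that $(d_P)$ lies in a face of the cube containing $(c_P)$, i.e. $d_P=c_P$ whenever $c_P=0$ or $c_P=1$. Then there is a fully faithful inclusion functor $$\overline{\mathcal{M}}_{1,n}((d_P))\hookrightarrow\overline{\mathcal{M}}_{1,n}((c_P)).$$
   Context: Everything is over $\mathbb{Z}[1/6]$. $\mathrm{Part}(n)$ is the set of partitions of $\{1,\dots,n\}$, ordered by $P_1\preceq P_2$ iff $P_2$ refines $P_1$ ($\prec$ is the strict relation). $X_{1,n}\subseteq[0,1]^{\mathrm{Part}(n)}$ is the set of tuples $(c_P)$ such that (i) whenever $P_1\prec P_2$ and $c_{P_2}>0$, then $c_{P_1}=1$; (ii) $c_{\{\{1\},\dots,\{n\}\}}=0$. It is a cube complex whose open cells are the intersections of the open cells of $[0,1]^{\mathrm{Part}(n)}$ with $X_{1,n}$. Levels. For a closed point $p$ of a reduced curve $C$ over an algebraically closed field $k$ with normalization $\nu:\tilde C\to C$, put $m(p)=|\nu^{-1}(p)|$, $\delta(p)=\dim_k(\nu_*\mathcal{O}_{\tilde C}/\mathcal{O}_C)_p$, $g(p)=\delta(p)-m(p)+1$; $p$ is an elliptic Gorenstein singularity if $\mathcal{O}_{C,p}$ is Gorenstein and $g(p)=1$. Let $(C,p_1,\dots,p_n)$ be a proper connected reduced marked curve of arithmetic genus one over an algebraically closed field, with divisor of markings $\Sigma$. A subcurve is a connected reduced closed subscheme. For a subcurve $Z$ of genus one, $\mathrm{lev}(Z)$ is the partition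 of $\{1,\dots,n\}$ in which $a,b$ are in the same block iff $p_a,p_b$ lie in the same connected component of $(C-Z)\cup\Sigma$. For an elliptic Gorenstein singularity $q$, $\mathrm{lev}(q)$ is the partition in which $a,b$ are in the same block iff $p_a,p_b$ lie in the same connected component of the normalization of $C$ at $q$. $(c_P)$-stability. For $(c_P)\in X_{1,n}$ put $Q_{sing}=\{P\mid c_P>0\}$ and $Q_{curve}=\{P\mid c_P<1\}$. A family $(\pi:C\to S,\sigma_1,\dots,\sigma_n)$ is $(c_P)$-stable if it is a flat and proper family of connected, reduced, Gorenstein curves of arithmetic genus one with $n$ distinct (smooth) marked points and on each geometric fiber $C_s$: (i) if $p\in C_s$ is an elliptic Gorenstein singularity, $\mathrm{lev}(p)\in Q_{sing}$; (ii) if $Z\subseteq C_s$ is a connected subcurve of genus one, $\mathrm{lev}(Z)\in Q_{curve}$; (iii) if $Z_1\subsetneq Z_2$ is a proper inclusion of connected subcurves of $C_s$ of arithmetic genus one, $\mathrm{lev}(Z_1)\prec\mathrm{lev}(Z_2)$; (iv) if $F$ is an irreducible component of the minimal genus one subcurve $Z_{min}$ of $C_s$, then $F$ meets $\overline{C_s-Z_{min}}\cup\{\sigma_1(s),\dots,\sigma_n(s)\}$ in at least one point. $\overline{\mathcal{M}}_{1,n}((c_P))$ is the stack (over $\mathbb{Z}[1/6]$) whose $S$-points are the $(c_P)$-stable families over $S$. *)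

(* Defs.v *)
From HB Require Import structures.
From mathcomp Require Import all_boot all_order all_algebra.
From mathcomp Require Import all_classical all_reals all_analysis.
Set Implicit Arguments.
Unset Strict Implicit.
Unset Printing Implicit Defensive.
Import Order.TTheory GRing.Theory Num.Theory.
Local Open Scope classical_set_scope.
Local Open Scope ring_scope.

Record category := Category {
  ob : Type;
  hom : ob -> ob -> Type;
  idc : forall X, hom X X;
  compc : forall X Y Z, hom Y Z -> hom X Y -> hom X Z;
  compc1 : forall X Y (f : hom X Y), compc f (idc X) = f;
  comp1c : forall X Y (f : hom X Y), compc (idc Y) f = f;
  compcA : forall X Y Z W (f : hom Z W) (g : hom Y Z) (h : hom X Y),
    compc f (compc g h) = compc (compc f g) h
}.

Record functor (C D : category) := Functor {
  fob : ob C -> ob D;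
  fhom : forall X Y, @hom C X Y -> @hom D (fob X) (fob Y);
  fhom1 : forall X, fhom (idc X) = idc (fob X);
  fhomM : forall X Y Z (f : @hom C Y Z) (g : @hom C X Y),
    fhom (compc f g) = compc (fhom f) (fhom g)
}.

Definition functor_comp (C D E : category)
  (G : functor D E) (F : functor C D) : functor C E.
Proof.
refine (@Functor C E (fun X => fob G (fob F X))
          (fun X Y f => fhom G (fhom F f)) _ _).
- by move=> X; rewrite !fhom1.
- by move=> X Y Z f g; rewrite !fhomM.
Defined.

Definition fully_faithful (C D : category) (F : functor C D) : Prop :=
  forall X Y, bijective (@fhom C D F X Y).

Definition full_subcategory (C : category) (P : ob C -> Prop) : category :=
  @Category {X : ob C | P X} (fun X Y => hom (sval X) (sval Y))
    (fun X => idc (sval X)) (fun X Y Z f g => compc f g)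
    (fun X Y f => compc1 f) (fun X Y f => comp1c f)
    (fun X Y Z W f g h => compcA f g h).

Definition full_subcategory_incl (C : category) (P : ob C -> Prop) :
    functor (full_subcategory P) C :=
  @Functor (full_subcategory P) C (fun X => sval X) (fun X Y f => f)
    (fun X => erefl) (fun X Y Z f g => erefl).

Definition invertible (A : comPzRingType) (a : A) : Prop :=
  exists b, a * b = 1.

Definition is_ideal (A : comPzRingType) (I : set A) : Prop :=
  [/\ I 0, forall a b, I a -> I b -> I (a + b) & forall a b, I b -> I (a * b)].

Definition prime_ideal (A : comPzRingType) (p : set A) : Prop :=
  [/\ is_ideal p, ~ p 1 & forall a b, p (a * b) -> p a \/ p b].

Definition noetherian (A : comNzRingType) : Prop :=
  forall I : set A, is_ideal I -> exists m (g : 'I_m -> A),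
    forall a, I a <-> exists c : 'I_m -> A, a = \sum_j c j * g j.

Definition reduced_ring (A : comNzRingType) : Prop :=
  forall (a : A) m, a ^+ m = 0 -> a = 0.

Definition domain_ring (A : comNzRingType) : Prop :=
  forall a b : A, a * b = 0 -> a = 0 \/ b = 0.

(* The equation in the second clause says that [a / b] is a root of the monic
   polynomial [p], with denominators cleared. *)
Definition integrally_closed (A : comNzRingType) : Prop :=
  domain_ring A /\
  forall (a b : A) (p : {poly A}), b != 0 -> p \is monic ->
    \sum_(i < size p) p`_i * a ^+ i * b ^+ ((size p).-1 - i) = 0 ->
    exists c, a = c * b.

(* For a Noetherian local ring: regular of dimension one.  At a closed point of a
   curve over an algebraically closed field this is smoothness. *)
Definition regular_dim1 (A : comNzRingType) : Prop :=
  exists t : A, [/\ ~ invertible t, forall a, t * a = 0 -> a = 0 &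
    forall a, ~ invertible a -> exists b, a = t * b].

Definition injective_module (A : comNzRingType) (I : lmodType A) : Prop :=
  forall (M N : lmodType A) (u : {linear M -> N}) (f : {linear M -> I}),
    injective u -> exists g : {linear N -> I}, forall x, g (u x) = f x.

Fixpoint inj_dim_le (A : comNzRingType) (d : nat) (M : lmodType A) : Prop :=
  match d with
  | 0%N => injective_module M
  | d'.+1 => exists (I N : lmodType A) (u : {linear M -> I})
      (v : {linear I -> N}),
      [/\ injective_module I, injective u, forall y, exists x, v x = y,
          forall x, v x = 0 <-> exists y, u y = x & inj_dim_le d' N]
  end.

Definition gorenstein_local (A : comNzRingType) : Prop :=
  noetherian A /\ exists d, inj_dim_le d (A^o : lmodType A).

Section Flatness.
Variables (A B : comNzRingType) (phi : {rmorphism A -> B}).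

Definition balanced (N : lmodType A) (T : zmodType) (b : N -> B -> T) : Prop :=
  [/\ forall x y m, b (x + y) m = b x m + b y m,
      forall x m l, b x (m + l) = b x m + b x l &
      forall r x m, b (r *: x) m = b x (phi r * m)].

Definition is_tensor (N : lmodType A) (T : zmodType) (b : N -> B -> T) : Prop :=
  balanced b /\
  forall (T' : zmodType) (b' : N -> B -> T'), balanced b' ->
    exists! h : {additive T -> T'}, forall x m, h (b x m) = b' x m.

Definition flat_rmorphism : Prop :=
  forall (N N' : lmodType A) (u : {linear N -> N'}), injective u ->
  forall (T T' : zmodType) (b : N -> B -> T) (b' : N' -> B -> T')
    (h : {additive T -> T'}),
    is_tensor b -> is_tensor b' -> (forall x m, h (b x m) = b' (u x) m) ->
    injective h.

End Flatness.

Definition finite_type_algebra (A B : comPzRingType)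
    (theta : {rmorphism A -> B}) : Prop :=
  exists m (g : 'I_m -> B), forall P : set B,
    (forall a, P (theta a)) -> (forall j, P (g j)) ->
    (forall x y, P x -> P y -> P (x + y)) ->
    (forall x y, P x -> P y -> P (x * y)) -> forall b, P b.

Definition module_finite (A B : comPzRingType)
    (theta : {rmorphism A -> B}) : Prop :=
  exists m (g : 'I_m -> B), forall b, exists c : 'I_m -> A,
    b = \sum_j theta (c j) * g j.

(* [quot_dim alg Z B m] : the quotient of the k-subspace [Z] of [\prod_i W i]
   by its k-subspace [B] has dimension [m]. *)
Definition quot_dim (k : comNzRingType) (I : Type) (W : I -> comNzRingType)
    (alg : forall i, k -> W i) (Z B : set (forall i, W i)) (m : nat) : Prop :=
  exists e : 'I_m -> forall i, W i, (forall j, Z (e j)) /\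
    forall s, Z s -> exists! c : 'I_m -> k,
      B (fun i => s i - \sum_j alg i (c j) * e j i).

(* The structure sheaf is given by its espace etale: the stalks, together with
   the predicate [regular x s] saying that the family of germs [s] comes from a
   section of the sheaf on some neighborhood of [x] (the values of [s] away from
   [x] are irrelevant).  The ring of sections over an open [U] consists of the
   families on [U] that are regular at every point of [U]. *)
Record lrs := LRS {
  pts :> topologicalType;
  stalk : pts -> comNzRingType;
  regular : forall x : pts, (forall z, stalk z) -> Prop;
  regular_near : forall x s, regular x s -> \forall z \near x, regular z s;
  regular_ext : forall x s t,
    regular x s -> (\forall z \near x, s z = t z) -> regular x t;
  regular1 : forall x, regular x (fun z => 1);
  regularB : forall x s t,
    regular x s -> regular x t -> regular x (fun z => s z - t z);
  regularM : forall x s t,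
    regular x s -> regular x t -> regular x (fun z => s z * t z);
  germ_exists : forall x (a : stalk x), exists s, regular x s /\ s x = a;
  germ_unique : forall x s,
    regular x s -> s x = 0 -> \forall z \near x, s z = 0;
  stalk_local : forall x (a : stalk x), invertible a \/ invertible (1 - a)
}.

Record mor (X Y : lrs) := Mor {
  base :> X -> Y;
  comor : forall x, {rmorphism stalk (base x) -> stalk x};
  base_continuous : continuous base;
  comor_regular : forall x s,
    regular (base x) s -> regular x (fun z => comor z (s (base z)));
  comor_local : forall x a, invertible (comor x a) -> invertible a
}.

Definition mor_id (X : lrs) : mor X X.
Proof.
refine (@Mor X X (fun x => x) (fun x => idfun) _ _ _) => //.
by move=> x; exact: cvg_id.
Defined.

Definition mor_comp (X Y Z : lrs) (g : mor Y Z) (f : mor X Y) : mor X Z.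
Proof.
refine (@Mor X Z (fun x => g (f x))
  (fun x => (comor f x \o comor g (f x) : {rmorphism _ -> _})) _ _ _).
- by move=> x; apply: continuous_comp; apply: base_continuous.
- move=> x s sreg /=.
  exact: (comor_regular (comor_regular sreg)).
- by move=> x a /= /comor_local /comor_local.
Defined.

Lemma rmorphism_ext (A B : comNzRingType) (f g : {rmorphism A -> B}) :
  (forall a, f a = g a) -> f = g.
Proof.
case: f g => f [f1 f2] [g [g1 g2]] /= /funext fg; subst g.
case: f1 f2 g1 g2 => [a] [m] [a'] [m'].
by rewrite (Prop_irrelevance a a') (Prop_irrelevance m m').
Qed.

Lemma mor_ext (X Y : lrs) (b : X -> Y)
    (f g : forall x, {rmorphism stalk (b x) -> stalk x}) c1 c2 r1 r2 l1 l2 :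
  (forall x a, f x a = g x a) ->
  @Mor X Y b f c1 r1 l1 = @Mor X Y b g c2 r2 l2.
Proof.
move=> fg; have {}fg : f = g.
  by apply: functional_extensionality_dep => x; exact: rmorphism_ext.
by subst g; congr Mor; exact: Prop_irrelevance.
Qed.

Lemma mor_comp1 (X Y : lrs) (f : mor X Y) : mor_comp f (mor_id X) = f.
Proof. by case: f => *; exact: mor_ext. Qed.

Lemma mor_1comp (X Y : lrs) (f : mor X Y) : mor_comp (mor_id Y) f = f.
Proof. by case: f => *; exact: mor_ext. Qed.

Lemma mor_compA (X Y Z W : lrs) (f : mor Z W) (g : mor Y Z) (h : mor X Y) :
  mor_comp f (mor_comp g h) = mor_comp (mor_comp f g) h.
Proof. exact: mor_ext. Qed.

(* [U] is open and the ring morphisms [a |-> phi a x] induce an isomorphism of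
   locally ringed spaces from [U] onto [Spec A]: the map sending [x] to the
   inverse image of the maximal ideal at [x] is a homeomorphism from [U] to the
   set of primes of [A], and each stalk is the localization of [A] at the
   corresponding prime.  The values [phi a x] for [x] outside [U] are
   irrelevant. *)
Definition affine_chart (X : lrs) (U : set X) (A : comPzRingType)
    (phi : A -> forall x : X, stalk x) : Prop :=
  [/\ open U,
      (forall x, U x -> zmod_morphism (phi^~ x) /\ monoid_morphism (phi^~ x)),
      (forall a x, U x -> regular x (phi a)),
      [/\ (forall p : set A, prime_ideal p -> exists! x, U x /\
              p = [set a | ~ invertible (phi a x)]) &
          (forall V x, open V -> V x -> U x -> exists f : A,
              invertible (phi f x) /\
              [set z | U z /\ invertible (phi f z)] `<=` V)] &
      (forall x, U x ->
          (forall b : stalk x, exists a s : A,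
              invertible (phi s x) /\ b * phi s x = phi a x) /\
          (forall a : A, phi a x = 0 ->
              exists s : A, invertible (phi s x) /\ s * a = 0))].

Definition is_scheme (X : lrs) : Prop :=
  forall x : X, exists U (A : comPzRingType) (phi : A -> forall z : X, stalk z),
    U x /\ affine_chart U phi.

Record scheme := Scheme { scheme_lrs :> lrs; schemeP : is_scheme scheme_lrs }.

Definition is_pullback (X S T P : scheme) (f : mor X S) (g : mor T S)
    (p : mor P X) (q : mor P T) : Prop :=
  mor_comp f p = mor_comp g q /\
  forall (W : scheme) (a : mor W X) (b : mor W T),
    mor_comp f a = mor_comp g b ->
    exists! h : mor W P, mor_comp p h = a /\ mor_comp q h = b.

Definition spec_point := unit.
HB.instance Definition _ := Choice.on spec_point.

Definition spec_point_open : set (set spec_point) := setT.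

Fact spec_point_openT : spec_point_open setT. Proof. by []. Qed.
Fact spec_point_openI (A B : set spec_point) : spec_point_open A -> spec_point_open B ->
  spec_point_open (A `&` B). Proof. by []. Qed.
Fact spec_point_open_bigU (I : Type) (f : I -> set spec_point) :
  (forall i, spec_point_open (f i)) -> spec_point_open (\bigcup_i f i).
Proof. by []. Qed.

HB.instance Definition _ :=
  isOpenTopological.Build spec_point spec_point_openT
    spec_point_openI spec_point_open_bigU.

Section SpecField.
Variable k : fieldType.

Definition spec_field_lrs : lrs.
Proof.
refine (@LRS spec_point (fun _ => k) (fun _ _ => True) _ _ _ _ _ _ _ _) => //.
- by move=> x s _; exact: filterT.
- by move=> x a; exists (fun _ => a); split.
- by case=> s _ s0; apply: filterE => -[].
- move=> _ a; have [->|a0] := eqVneq a 0.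
    by right; exists 1; rewrite subr0 mulr1.
  by left; exists a^-1; rewrite mulfV.
Defined.

Lemma spec_field_is_scheme : is_scheme spec_field_lrs.
Proof.
move=> x; exists setT, k, (fun a _ => a); split => //; split.
- exact: openT.
- by move=> ? _; split => //; split.
- by [].
- split.
    move=> p [[p0 pD pM] p1 pP]; exists tt; split; last by move=> [].
    split=> //; apply/seteqP; split=> a /=.
      move=> pa [b ab]; apply: p1; rewrite -ab mulrC; exact: pM.
    move=> na; have [->//|a0] := eqVneq a 0.
    by exfalso; apply: na; exists a^-1; rewrite mulfV.
  move=> V [] oV Vx _; exists 1; split; first by exists 1; rewrite mulr1.
  by move=> [] _.
- move=> [] _; split.
    move=> b; exists b, 1; rewrite mulr1; split=> //.
    by exists 1; rewrite mulr1.
  by move=> a ->; exists 1; rewrite mulr0; split=> //; exists 1; rewrite mulr1.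
Qed.

Definition spec_field : scheme := Scheme spec_field_is_scheme.
End SpecField.

Definition closed_immersion (X Y : scheme) (f : mor X Y) : Prop :=
  [/\ injective f, forall B : set X, closed B -> closed (f @` B) &
      forall x (a : stalk x), exists b, comor f x b = a].

Definition separated (X Y : scheme) (f : mor X Y) : Prop :=
  forall (P : scheme) (p q : mor P X) (D : mor X P),
    is_pullback f f p q -> mor_comp p D = mor_id X ->
    mor_comp q D = mor_id X -> closed_immersion D.

Section MorphismProperties.
Variables (X Y : scheme) (f : mor X Y).

Definition universally_closed : Prop :=
  forall (Y' P : scheme) (g : mor Y' Y) (p : mor P X) (q : mor P Y'),
    is_pullback f g p q -> forall B : set P, closed B -> closed (q @` B).

Definition chart_morphism (U : set X) (A : comPzRingType)
    (phi : A -> forall x : X, stalk x) (B : comPzRingType)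
    (psi : B -> forall y : Y, stalk y) (theta : {rmorphism B -> A}) : Prop :=
  forall b x, U x -> phi (theta b) x = comor f x (psi b (f x)).

Definition locally_of_finite_type : Prop :=
  forall x : X, exists (U : set X) (A : comPzRingType)
    (phi : A -> forall x : X, stalk x) (V : set Y) (B : comPzRingType)
    (psi : B -> forall y : Y, stalk y) (theta : {rmorphism B -> A}),
    [/\ U x, U `<=` f @^-1` V, affine_chart U phi, affine_chart V psi &
        chart_morphism U phi psi theta /\ finite_type_algebra theta].

Definition quasi_compact : Prop :=
  forall (V : set Y) (B : comPzRingType) (psi : B -> forall y : Y, stalk y),
    affine_chart V psi -> compact (f @^-1` V).

Definition proper_mor : Prop :=
  [/\ separated f, locally_of_finite_type, quasi_compact & universally_closed].

Definition flat_mor : Prop := forall x, flat_rmorphism (comor f x).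

Definition finite_mor : Prop :=
  forall y : Y, exists (V : set Y) (A : comPzRingType)
    (phi : A -> forall x : X, stalk x) (B : comPzRingType)
    (psi : B -> forall y : Y, stalk y) (theta : {rmorphism B -> A}),
    [/\ V y, affine_chart (f @^-1` V) phi, affine_chart V psi &
        chart_morphism (f @^-1` V) phi psi theta /\ module_finite theta].

Definition iso_over (V : set Y) : Prop :=
  [/\ forall y, V y -> exists! x, f x = y,
      forall W : set X, open W -> W `<=` f @^-1` V -> open (f @` W) &
      forall x, V (f x) -> bijective (comor f x)].

Definition normalization : Prop :=
  [/\ finite_mor, forall x : X, integrally_closed (stalk x) &
      exists V : set Y,
        [/\ open V, dense V, dense (f @^-1` V) & iso_over V]].

Definition normalization_at (q : Y) : Prop :=
  [/\ finite_mor,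
      forall x : X, f x = q -> integrally_closed (stalk x),
      dense (f @^-1` [set~ q]) & iso_over [set~ q]].
End MorphismProperties.

Definition irreducible_set (T : topologicalType) (F : set T) : Prop :=
  F !=set0 /\ forall B C : set T, closed B -> closed C ->
    F `<=` B `|` C -> F `<=` B \/ F `<=` C.

Definition irreducible_component (T : topologicalType) (Z F : set T) : Prop :=
  [/\ irreducible_set F, closed F, F `<=` Z &
      forall G : set T, irreducible_set G -> closed G -> G `<=` Z ->
        F `<=` G -> G = F].

Definition krull_dim1 (T : topologicalType) : Prop :=
  let irr_closed (F : set T) := irreducible_set F /\ closed F in
  (exists F G, [/\ irr_closed F, irr_closed G & F `<` G]) /\
  forall F G H, irr_closed F -> irr_closed G -> irr_closed H ->
    ~ (F `<` G /\ G `<` H).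

Definition connected_scheme (X : scheme) : Prop :=
  [set: X] !=set0 /\ connected [set: X].

Definition reduced (X : scheme) : Prop :=
  forall x : X, reduced_ring (stalk x).

Definition gorenstein (X : scheme) : Prop :=
  forall x : X, gorenstein_local (stalk x).

Section ArithmeticGenus.
Variables (k : closedFieldType) (X : scheme) (p : mor X (spec_field k)).

Definition scalar (x : X) (a : k) : stalk x := comor p x a.

Definition h0_is (m : nat) : Prop :=
  @quot_dim k X (fun x => stalk x) scalar
    [set s | forall x, regular x s] [set s | forall x, s x = 0] m.

(* H^1(X, O_X) is the Cech cohomology group, i.e. the colimit of the Cech
   groups of all open coverings; coverings of the form (U_x)_{x in X} with
   [U_x] a neighborhood of [x] are cofinal, and [s (x, y, -)] is the component
   of the cochain on [U_x `&` U_y]. *)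
Definition cech1 := forall i : X * X * X, stalk i.2.

Definition pointed_cover (U : X -> set X) : Prop :=
  forall x, open (U x) /\ U x x.

Definition cech_cocycle (s : cech1) : Prop :=
  exists U : X -> set X, [/\ pointed_cover U,
    forall x y z, U x z -> U y z -> regular z (fun w => s (x, y, w)) &
    forall x y w z, U x z -> U y z -> U w z ->
      s (x, y, z) + s (y, w, z) = s (x, w, z)].

Definition cech_coboundary (s : cech1) : Prop :=
  exists (U : X -> set X) (t : forall x z : X, stalk z),
    [/\ pointed_cover U, forall x z, U x z -> regular z (t x) &
    forall x y z, U x z -> U y z -> s (x, y, z) = t y z - t x z].

Definition h1_is (m : nat) : Prop :=
  @quot_dim k (X * X * X)%type (fun i => stalk i.2) (fun i => @scalar i.2)
    cech_cocycle cech_coboundary m.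

(* 1 - chi(O_X), for X of dimension at most one *)
Definition arith_genus_is (g : int) : Prop :=
  exists a b, [/\ h0_is a, h1_is b & g = 1 - (a%:Z - b%:Z)].
End ArithmeticGenus.

Definition Part (n : nat) :=
  {P : {set {set 'I_n}} | finset.partition P [set: 'I_n]%SET}.

Definition part_le (n : nat) (P1 P2 : Part n) : Prop :=
  forall B, B \in val P2 -> exists2 A, A \in val P1 & B \subset A.

Definition part_lt (n : nat) (P1 P2 : Part n) : Prop :=
  part_le P1 P2 /\ P1 <> P2.

Definition same_block (n : nat) (P : Part n) (a b : 'I_n) : Prop :=
  exists2 B, B \in val P & (a \in B) && (b \in B).

Definition discrete_part (n : nat) (P : Part n) : Prop :=
  val P = [set [set a] | a in 'I_n]%SET.

(* X_{1,n}, as a subset of the cube [0,1]^Part(n) *)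
Definition X1 (R : realType) (n : nat) (c : Part n -> R) : Prop :=
  [/\ forall P, 0 <= c P <= 1,
      forall P1 P2, part_lt P1 P2 -> 0 < c P2 -> c P1 = 1 &
      forall P, discrete_part P -> c P = 0].

Definition Qsing (R : realType) (n : nat) (c : Part n -> R) : set (Part n) :=
  [set P | 0 < c P].

Definition Qcurve (R : realType) (n : nat) (c : Part n -> R) : set (Part n) :=
  [set P | c P < 1].

Record subcurve (X : scheme) := Subcurve {
  sub_scheme : scheme;
  sub_mor : mor sub_scheme X;
  sub_closed : closed_immersion sub_mor;
  sub_reduced : reduced sub_scheme;
  sub_connected : connected_scheme sub_scheme
}.

Definition supp (X : scheme) (Z : subcurve X) : set X := range (sub_mor Z).

Section MarkedCurve.
Variables (k : closedFieldType) (n : nat) (C : scheme).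
Variable p : mor C (spec_field k).
Variable tau : 'I_n -> mor (spec_field k) C.

Definition marking (a : 'I_n) : C := tau a tt.

(* [number_preimages nu q m], [delta_is nu q d], [sing_genus_is q g] are
   m(q) = m, delta(q) = d and g(q) = g. *)
Definition number_preimages (Y : scheme) (nu : mor Y C) (q : C) (m : nat) :
    Prop := (nu @^-1` [set q] #= `I_m)%card.

Definition delta_is (Y : scheme) (nu : mor Y C) (q : C) (d : nat) : Prop :=
  @quot_dim k Y (fun y => stalk y) (@scalar k Y (mor_comp p nu))
    [set s | \forall z \near q, forall y, nu y = z -> regular y s]
    [set s | exists t, regular q t /\ \forall z \near q,
        forall y, nu y = z -> s y = comor nu y (t (nu y))] d.

Definition sing_genus_is (q : C) (g : int) : Prop :=
  exists (Y : scheme) (nu : mor Y C) (m d : nat),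
    [/\ normalization nu, number_preimages nu q m, delta_is nu q d &
        g = d%:Z - m%:Z + 1].

Definition elliptic_gorenstein (q : C) : Prop :=
  [/\ closed [set q], gorenstein_local (stalk q) & sing_genus_is q 1].

Definition genus_one (Z : subcurve C) : Prop :=
  arith_genus_is (mor_comp p (sub_mor Z)) 1.

Definition lev_subcurve_is (Z : subcurve C) (P : Part n) : Prop :=
  forall a b, same_block P a b <->
    connected_component (~` supp Z `|` range marking) (marking a) (marking b).

(* A marking [p_a] is a smooth point, hence it has a unique preimage in the
   normalization at [q]. *)
Definition lev_singularity_is (q : C) (P : Part n) : Prop :=
  exists (Y : scheme) (nu : mor Y C), normalization_at nu q /\
    forall a b, same_block P a b <->
      exists ya yb, [/\ nu ya = marking a, nu yb = marking b &
        connected_component [set: Y] ya yb].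

Definition minimal_genus_one (Z : subcurve C) : Prop :=
  genus_one Z /\ forall Z' : subcurve C, genus_one Z' ->
    supp Z' `<=` supp Z -> supp Z' = supp Z.

Definition gorenstein_genus_one_curve : Prop :=
  [/\ connected_scheme C, reduced C, gorenstein C, krull_dim1 C &
      arith_genus_is p 1].

Definition distinct_smooth_markings : Prop :=
  injective marking /\ forall a, regular_dim1 (stalk (marking a)).

Definition stable_fiber (R : realType) (c : Part n -> R) : Prop :=
  [/\ forall q, elliptic_gorenstein q ->
        exists2 P, lev_singularity_is q P & Qsing c P,
      forall Z : subcurve C, genus_one Z ->
        exists2 P, lev_subcurve_is Z P & Qcurve c P,
      forall Z1 Z2 : subcurve C, genus_one Z1 -> genus_one Z2 ->
        supp Z1 `<` supp Z2 ->
        exists P1 P2, [/\ lev_subcurve_is Z1 P1, lev_subcurve_is Z2 P2 &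
                          part_lt P1 P2] &
      forall (Z : subcurve C) (F : set C), minimal_genus_one Z ->
        irreducible_component (supp Z) F ->
        F `&` (closure (~` supp Z) `|` range marking) !=set0].
End MarkedCurve.

Definition scheme_category : category :=
  @Category scheme (fun X Y => mor X Y) (fun X => mor_id X)
    (fun X Y Z g f => mor_comp g f) (fun X Y => @mor_comp1 X Y)
    (fun X Y => @mor_1comp X Y) (fun X Y Z W => @mor_compA X Y Z W).

(* Schemes over Z[1/6]: the structure morphism exists if and only if 6 is
   invertible, and it is then unique. *)
Definition schemes_over_Z6 : category :=
  @full_subcategory scheme_category
    (fun S : scheme => forall x : S, invertible (6%:R : stalk x)).

Record family (n : nat) := Family {
  fam_base : ob schemes_over_Z6;
  fam_total : scheme;
  fam_pi : mor fam_total (sval fam_base);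
  fam_sec : 'I_n -> mor (sval fam_base) fam_total;
  fam_secK : forall a, mor_comp fam_pi (fam_sec a) = mor_id (sval fam_base)
}.

Record family_hom (n : nat) (X Y : family n) := FamilyHom {
  hom_base : @hom schemes_over_Z6 (fam_base X) (fam_base Y);
  hom_total : mor (fam_total X) (fam_total Y);
  hom_cartesian : is_pullback (fam_pi Y) hom_base hom_total (fam_pi X);
  hom_sec : forall a,
    mor_comp hom_total (fam_sec X a) = mor_comp (fam_sec Y a) hom_base
}.

Lemma family_hom_ext (n : nat) (X Y : family n) (f g : family_hom X Y) :
  hom_base f = hom_base g -> hom_total f = hom_total g -> f = g.
Proof.
case: f g => fb ft fc fs [gb gt gc gs] /= fgb fgt; subst gb gt.
by congr FamilyHom; exact: Prop_irrelevance.
Qed.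

Lemma pullback_id (X S : scheme) (f : mor X S) :
  is_pullback f (mor_id S) (mor_id X) f.
Proof.
split; first by rewrite mor_comp1 mor_1comp.
move=> W a b; rewrite mor_1comp => <-.
by exists a; split; [rewrite mor_1comp|move=> h [<- _]; rewrite mor_1comp].
Qed.

Lemma pullback_paste (X S X' S' X'' S'' : scheme)
    (f : mor X S) (f' : mor X' S') (f'' : mor X'' S'')
    (g : mor S' S) (g' : mor S'' S') (h : mor X' X) (h' : mor X'' X') :
  is_pullback f g h f' -> is_pullback f' g' h' f'' ->
  is_pullback f (mor_comp g g') (mor_comp h h') f''.
Proof.
move=> [e1 u1] [e2 u2]; split.
  by rewrite mor_compA e1 -mor_compA e2 mor_compA.
move=> W a b; rewrite -mor_compA => /u1[l [[la lb] lu]].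
have [m [[ma mb] mu]] := u2 _ _ _ lb.
exists m; split; first by split=> //; rewrite -mor_compA ma.
move=> m' [ma' mb']; apply: mu; split=> //; symmetry; apply: lu.
by split; rewrite mor_compA // e2 -mor_compA mb'.
Qed.

Definition family_id (n : nat) (X : family n) : family_hom X X.
Proof.
refine (@FamilyHom n X X (idc (fam_base X)) (mor_id _) _ _).
- exact: pullback_id.
- by move=> a; rewrite mor_1comp mor_comp1.
Defined.

Definition family_comp (n : nat) (X Y Z : family n)
  (f : family_hom Y Z) (g : family_hom X Y) : family_hom X Z.
Proof.
refine (@FamilyHom n X Z (compc (hom_base f) (hom_base g))
          (mor_comp (hom_total f) (hom_total g)) _ _).
- exact: pullback_paste (hom_cartesian f) (hom_cartesian g).
- by move=> a; rewrite -mor_compA hom_sec !mor_compA hom_sec.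
Defined.

Definition family_category (n : nat) : category.
Proof.
refine (@Category (family n) (@family_hom n) (@family_id n) (@family_comp n)
          _ _ _).
- by move=> X Y f; apply: family_hom_ext; exact: mor_comp1.
- by move=> X Y f; apply: family_hom_ext; exact: mor_1comp.
- by move=> X Y Z W f g h; apply: family_hom_ext; exact: mor_compA.
Defined.

Definition family_base (n : nat) : functor (family_category n) schemes_over_Z6 :=
  @Functor (family_category n) schemes_over_Z6 (@fam_base n)
    (fun X Y f => hom_base f) (fun X => erefl) (fun X Y Z f g => erefl).

Definition stable_family (R : realType) (n : nat) (c : Part n -> R)
    (X : family n) : Prop :=
  [/\ flat_mor (fam_pi X), proper_mor (fam_pi X) &
    forall (k : closedFieldType) (s : mor (spec_field k) (sval (fam_base X)))
      (C : scheme) (q : mor C (fam_total X)) (p : mor C (spec_field k))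
      (tau : 'I_n -> mor (spec_field k) C),
      is_pullback (fam_pi X) s q p ->
      (forall a, mor_comp q (tau a) = mor_comp (fam_sec X a) s) ->
      (forall a, mor_comp p (tau a) = mor_id (spec_field k)) ->
      [/\ gorenstein_genus_one_curve p, distinct_smooth_markings tau &
          stable_fiber p tau c]].

(* The stack of c-stable families, as a category fibered in groupoids over
   schemes over Z[1/6]. *)
Definition Mbar (R : realType) (n : nat) (c : Part n -> R) : category :=
  @full_subcategory (family_category n) (stable_family c).

Definition Mbar_family (R : realType) (n : nat) (c : Part n -> R) :
    functor (Mbar c) (family_category n) :=
  @full_subcategory_incl (family_category n) (stable_family c).

Definition Mbar_base (R : realType) (n : nat) (c : Part n -> R) :
    functor (Mbar c) schemes_over_Z6 :=
  functor_comp (family_base n) (Mbar_family c).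

(* The smallest face of the cube [0,1]^Part(n) containing [c] is cut out by fixing
   the coordinates at which [c] takes the value 0 or 1. *)
Definition in_face (R : realType) (n : nat) (c d : Part n -> R) : Prop :=
  forall P, c P = 0 \/ c P = 1 -> d P = c P.

(* Main.v *)
Require Import Defs.
From mathcomp Require Import all_boot all_order all_algebra.
From mathcomp Require Import all_classical all_reals all_analysis.

(** The parameter [c] enters the stability condition only through the two sets
    of levels [Qsing c] and [Qcurve c], and stability is monotone in each of
    them.  Both sets can only shrink when [c] is replaced by a point [d] of the
    smallest face of the cube containing [c]: a coordinate of [c] that is
    missing from [Qsing c] (resp. [Qcurve c]) equals 0 (resp. 1), so the face
    condition gives [d] the same coordinate.  Hence every [d]-stable family is
    [c]-stable ([stable_family_face]).  Both stacks are full subcategories of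
    one category of families, so the functor sought is the inclusion of one full
    subcategory in a larger one. *)

Import Order.TTheory GRing.Theory Num.Theory.
Local Open Scope classical_set_scope.
Local Open Scope ring_scope.

Section FullSubcategoryInclusion.
Context {C : category} {P Q : ob C -> Prop} (PQ : forall X, P X -> Q X).

Definition full_subcategory_sub :
    functor (full_subcategory P) (full_subcategory Q) :=
  @Functor (full_subcategory P) (full_subcategory Q)
    (fun X => exist Q (sval X) (PQ _ (svalP X))) (fun X Y f => f)
    (fun X => erefl) (fun X Y Z f g => erefl).

Lemma full_subcategory_sub_ff : fully_faithful full_subcategory_sub.
Proof. by move=> X Y; exists id. Qed.

(** Both sides send objects and arrows to convertible terms and differ only in
    the proofs of the functor laws; this is why an equality of functors, and not
    merely a natural isomorphism, is available. *)
Lemma full_subcategory_sub_incl :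
  functor_comp (full_subcategory_incl Q) full_subcategory_sub =
  full_subcategory_incl P.
Proof. by congr Functor; exact: Prop_irrelevance. Qed.

End FullSubcategoryInclusion.

Lemma functor_compA {A B C D : category} (H : functor C D) (G : functor B C)
    (F : functor A B) :
  functor_comp (functor_comp H G) F = functor_comp H (functor_comp G F).
Proof. by congr Functor; exact: Prop_irrelevance. Qed.

Section Monotonicity.
Context {R : realType} {n : nat} {c d : Part n -> R}.

Lemma Qsing_face (c_ge0 : forall P, 0 <= c P) :
  in_face c d -> Qsing d `<=` Qsing c.
Proof.
move=> face P; rewrite /Qsing /= => d_gt0; rewrite lt_neqAle c_ge0 andbT.
apply/eqP => c0.
by move: d_gt0; rewrite face -c0 ?ltxx //; left.
Qed.

Lemma Qcurve_face (c_le1 : forall P, c P <= 1) :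
  in_face c d -> Qcurve d `<=` Qcurve c.
Proof.
move=> face P; rewrite /Qcurve /= => d_lt1; rewrite lt_neqAle c_le1 andbT.
apply/eqP => c1.
by move: d_lt1; rewrite face c1 ?ltxx //; right.
Qed.

(** Only the first two clauses of [stable_fiber] mention the parameter, each as
    the membership of a level in [Qsing] or [Qcurve]; the other clauses and the
    conditions on the family are the same for [c] and [d]. *)
Lemma stable_family_sub : Qsing d `<=` Qsing c -> Qcurve d `<=` Qcurve c ->
  forall X, stable_family d X -> stable_family c X.
Proof.
move=> sing curve X [flatX properX fiberX]; split=> // k s C q p tau Cs qt pt.
have [gor mark [ellip genus strict meets]] := fiberX _ _ _ _ _ _ Cs qt pt.
split=> //; split=> //.
- by move=> x /ellip[P levP /sing]; exists P.
- by move=> Z /genus[P levP /curve]; exists P.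
Qed.

Lemma stable_family_face : X1 c -> in_face c d ->
  forall X, stable_family d X -> stable_family c X.
Proof.
move=> [c01 _ _] face; apply: stable_family_sub.
- by apply: Qsing_face face => P; have /andP[] := c01 P.
- by apply: Qcurve_face face => P; have /andP[] := c01 P.
Qed.

End Monotonicity.

Theorem theorem7p8 (R : realType) (n : nat) (c d : Part n -> R)
  (n_ge1 : (1 <= n)%N) (Xc : X1 c) (Xd : X1 d) (face : in_face c d) :
  exists F : functor (Mbar d) (Mbar c),
    [/\ fully_faithful F,
        functor_comp (Mbar_base c) F = Mbar_base d &
        functor_comp (Mbar_family c) F = Mbar_family d].
Proof.
have sub : forall X : ob (family_category n), stable_family d X ->
  stable_family c X := stable_family_face Xc face.
exists (full_subcategory_sub sub).
have incl := full_subcategory_sub_incl sub.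
split.
- exact: full_subcategory_sub_ff.
(* [Mbar_base] is by definition [family_base] after [Mbar_family]. *)
- by rewrite functor_compA; congr functor_comp; exact: incl.
- exact: incl.
Qed.
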